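(* Let $\mu\ge0$, $s>0$, and let $f:\mathbb{R}^n\to\mathbb{R}$ be continuously differentiable, $\mu$-strongly convex (possibly $\mu=0$) and $(1/s)$-smooth, with a minimizer $x^*$. Let $(\mathbf{t}_k)_{k=0}^\infty$ be a strictly increasing sequence in $[0,\infty)$ satisfying $$\frac{2\sqrt s}{\mathbf{t}_k}\operatorname{cothc}\left(\frac{\sqrt\mu}{2}\mathbf{t}_k\right)\le1\quad\text{for all }k\ge2$$ and $$\left(1-\frac{2\sqrt s}{\mathbf{t}_{k+1}}\operatorname{cothc}\left(\frac{\sqrt\mu}{2}\mathbf{t}_{k+1}\right)\right)\frac{\mathbf{t}_{k+1}^2}{4}\operatorname{sinhc}^2\left(\frac{\sqrt\mu}{2}\mathbf{t}_{k+1}\right)\le\frac{\mathbf{t}_k^2}{4}\operatorname{sinhc}^2\left(\frac{\sqrt\mu}{2}\mathbf{t}_k\right)\quad\text{for all }k\ge0.$$ Let the iterates of the unified NAG family be generated from $x_0=z_0\in\mathbb{R}^n$ by, for $k\ge0$, $$y_k=x_k+\frac{\frac{2\sqrt s}{\mathbf{t}_{k+1}}\operatorname{cothc}\left(\frac{\sqrt\mu}{2}\mathbf{t}_{k+1}\right)-\mu s}{1-\mu s}(z_k-x_k),\qquad x_{k+1}=y_k-s\nabla f(y_k),$$ $$z_{k+1}=z_k+\frac{\sqrt s\,\mathbf{t}_{k+1}}{2}\operatorname{tanhc}\left(\frac{\sqrt\mu}{2}\mathbf{t}_{k+1}\right)\left(\mu y_k-\mu z_k-\nabla f(y_k)\right).$$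 Then the sequence $$\mathcal{E}_k=\frac12\cosh^2\left(\frac{\sqrt\mu}{2}\mathbf{t}_k\right)\|z_k-x^*\|^2+\frac{\mathbf{t}_k^2}{4}\operatorname{sinhc}^2\left(\frac{\sqrt\mu}{2}\mathbf{t}_k\right)\left(f(x_k)-f(x^* )\right)$$ is monotonically decreasing (non-increasing) in $k\ge0$.
   Context: $\operatorname{sinhc}(x)=\sinh(x)/x$ for $x\ne0$, $\operatorname{sinhc}(0)=1$; $\operatorname{tanhc}(x)=\operatorname{sinhc}(x)/\cosh(x)$; $\operatorname{cothc}(x)=1/\operatorname{tanhc}(x)$. $f$ is $\mu$-strongly convex if $f(y)\ge f(x)+\langle\nabla f(x),y-x\rangle+\frac{\mu}{2}\|y-x\|^2$ for all $x,y$; $f$ is $L$-smooth if $\nabla f$ is $L$-Lipschitz. *)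

(* Defs.v *)
From HB Require Import structures.
From mathcomp Require Import all_boot all_order all_algebra.
From mathcomp Require Import all_classical all_reals all_analysis.

Set Implicit Arguments.
Unset Strict Implicit.
Unset Printing Implicit Defensive.

Import Order.TTheory GRing.Theory Num.Theory.
Import numFieldNormedType.Exports.

Local Open Scope ring_scope.

Definition sinh (R : realType) (x : R) : R := (expR x - expR (- x)) / 2.

Definition cosh (R : realType) (x : R) : R := (expR x + expR (- x)) / 2.

Definition sinhc (R : realType) (x : R) : R :=
  if x == 0 then 1 else sinh x / x.

Definition tanhc (R : realType) (x : R) : R := sinhc x / cosh x.

Definition cothc (R : realType) (x : R) : R := 1 / tanhc x.

Definition dotp (R : realType) (n : nat) (u v : 'rV[R]_n) : R :=
  \sum_(i < n) u 0 i * v 0 i.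

(* The library norm [`|u|] on row vectors is the sup norm, hence this one.
   Both induce the same topology, so [differentiable] and [continuous] below
   have their usual meaning on R^n. *)
Definition enorm (R : realType) (n : nat) (u : 'rV[R]_n) : R :=
  Num.sqrt (dotp u u).

Definition grad (R : realType) (n : nat) (f : 'rV[R]_n -> R) (x : 'rV[R]_n) :
    'rV[R]_n :=
  \row_(i < n) 'D_(delta_mx 0 i) f x.

Definition continuously_differentiable (R : realType) (n : nat)
    (f : 'rV[R]_n -> R) : Prop :=
  (forall x, differentiable f x) /\ continuous (grad f).

Definition strongly_convex (R : realType) (n : nat) (mu : R)
    (f : 'rV[R]_n -> R) : Prop :=
  forall x y,
    f x + dotp (grad f x) (y - x) + mu / 2 * enorm (y - x) ^+ 2 <= f y.

Definition smooth (R : realType) (n : nat) (L : R) (f : 'rV[R]_n -> R) : Prop :=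
  forall x y, enorm (grad f x - grad f y) <= L * enorm (x - y).

Definition minimizer (R : realType) (n : nat) (f : 'rV[R]_n -> R)
    (xs : 'rV[R]_n) : Prop :=
  forall x, f xs <= f x.

(* Only [t k.+1] is inverted, so [t 0] may be 0. The division by [1 - mu * s]
   is genuine as soon as [2 sqrt s / t cothc (sqrt mu / 2 * t) <= 1] for some
   [t > 0]: for [mu > 0] the left-hand side is
   [sqrt (mu s) coth (sqrt mu / 2 * t) > sqrt (mu s)]. *)
Definition unified_NAG (R : realType) (n : nat) (mu s : R)
    (f : 'rV[R]_n -> R) (t : nat -> R) (x y z : nat -> 'rV[R]_n) : Prop :=
  x 0%N = z 0%N /\
  forall k : nat,
    [/\ y k = x k +
          ((2 * Num.sqrt s / t k.+1 * cothc (Num.sqrt mu / 2 * t k.+1) - mu * s)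
             / (1 - mu * s)) *: (z k - x k),
        x k.+1 = y k - s *: grad f (y k)
      & z k.+1 = z k +
          (Num.sqrt s * t k.+1 / 2 * tanhc (Num.sqrt mu / 2 * t k.+1)) *:
            (mu *: y k - mu *: z k - grad f (y k))].

Definition energy (R : realType) (n : nat) (mu : R) (f : 'rV[R]_n -> R)
    (t : nat -> R) (xs : 'rV[R]_n) (x z : nat -> 'rV[R]_n) (k : nat) : R :=
  1 / 2 * cosh (Num.sqrt mu / 2 * t k) ^+ 2 * enorm (z k - xs) ^+ 2
  + t k ^+ 2 / 4 * sinhc (Num.sqrt mu / 2 * t k) ^+ 2 * (f (x k) - f xs).

(* Main.v *)
Require Import Defs.
From HB Require Import structures.
From mathcomp Require Import all_boot all_order all_algebra.
From mathcomp Require Import all_classical all_reals all_analysis.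
From mathcomp Require Import ring lra.

Set Implicit Arguments.
Unset Strict Implicit.
Unset Printing Implicit Defensive.

Import Order.TTheory GRing.Theory Num.Theory.
Import numFieldNormedType.Exports.

Local Open Scope ring_scope.

(** The hyperbolic coefficients enter the proof only through two numbers
    attached to [t = t k.+1]: the weight [A = t^2/4 sinhc^2] of the function
    gap in the energy, and the ratio [a = 2 sqrt s / t cothc].  Since
    [cosh^2 - sinh^2 = 1], the weight of the squared distance is
    [cosh^2 = 1 + mu A] ([sqr_cosh_weight]); moreover
    [A a^2 = s (1 + mu A)] ([weight_ratio]) and the step length of [z] is
    [s / a] ([mirror_step]).

    The second condition on [t] says [(1 - a) A <= A_k], where [A_k] is the
    weight at [t k].  The energy at [k] is nondecreasing in its weight, the
    latter occurring both in [1 + mu A_k] and in front of a nonnegative gap,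
    so it suffices to bound the energy at [k.+1] by the expression obtained
    from the energy at [k] by putting [(1 - a) A] for [A_k].  This is the
    algebraic heart of the proof, [nag_step].  It adds up three inequalities at
    [y]: the decrease of [f] along the gradient step, weighted by [A]
    ([descent]), and the strong convexity bounds towards [x] and towards the
    minimizer, weighted by [(1 - a) A] and [a A].  The terms linear in the
    gradient cancel because of the choice of [y] on the line through [x] and
    [z]; what is left is [mu] times a quadratic form in [y - z] and [x - y]
    with coefficients [a - mu s] and [1 - a].

    These coefficients are nonnegative when [a <= 1] ([mus_lt_ratio]), which
    the first condition on [t] grants for [k >= 1].  At [k = 0] nothing bounds
    [a], but then [x = y = z]: the quadratic form vanishes, and the bound
    towards [x] is an equality, which may be multiplied by [1 - a] of any
    sign. *)

(** * Euclidean inner product *)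

Lemma dotpC (R : realType) (n : nat) (u v : 'rV[R]_n) : dotp u v = dotp v u.
Proof. by apply: eq_bigr => i _; rewrite mulrC. Qed.

Lemma dotpDl (R : realType) (n : nat) (u v w : 'rV[R]_n) :
  dotp (u + v) w = dotp u w + dotp v w.
Proof. by rewrite -big_split; apply: eq_bigr => i _; rewrite mxE mulrDl. Qed.

Lemma dotpZl (R : realType) (n : nat) (c : R) (u v : 'rV[R]_n) :
  dotp (c *: u) v = c * dotp u v.
Proof. by rewrite mulr_sumr; apply: eq_bigr => i _; rewrite mxE mulrA. Qed.

Lemma dotpNl (R : realType) (n : nat) (u v : 'rV[R]_n) :
  dotp (- u) v = - dotp u v.
Proof. by rewrite -scaleN1r dotpZl mulN1r. Qed.

Lemma dotpDr (R : realType) (n : nat) (u v w : 'rV[R]_n) :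
  dotp u (v + w) = dotp u v + dotp u w.
Proof. by rewrite dotpC dotpDl !(dotpC u). Qed.

Lemma dotpZr (R : realType) (n : nat) (c : R) (u v : 'rV[R]_n) :
  dotp u (c *: v) = c * dotp u v.
Proof. by rewrite dotpC dotpZl dotpC. Qed.

Lemma dotpNr (R : realType) (n : nat) (u v : 'rV[R]_n) :
  dotp u (- v) = - dotp u v.
Proof. by rewrite dotpC dotpNl dotpC. Qed.

Definition dotpE := (dotpDl, dotpDr, dotpNl, dotpNr, dotpZl, dotpZr).

Lemma dotp_ge0 (R : realType) (n : nat) (u : 'rV[R]_n) : 0 <= dotp u u.
Proof. by apply: sumr_ge0 => i _; rewrite -expr2 sqr_ge0. Qed.

Lemma sqr_enorm (R : realType) (n : nat) (u : 'rV[R]_n) :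
  enorm u ^+ 2 = dotp u u.
Proof. by rewrite sqr_sqrtr ?dotp_ge0. Qed.

(** The case of the Cauchy-Schwarz inequality needed for Lipschitz gradients:
    it follows from [0 <= |u - c v|^2], both [|u|^2] and [|c v|^2] being at
    most [c^2 |v|^2]. *)
Lemma dotp_le_of_enorm (R : realType) (n : nat) (u v : 'rV[R]_n) (c : R) :
  0 < c -> enorm u <= c * enorm v -> dotp u v <= c * dotp v v.
Proof.
move=> c0 uv.
have uu : dotp u u <= c ^+ 2 * dotp v v.
  by rewrite -!sqr_enorm -exprMn ler_pXn2r ?nnegrE ?mulr_ge0 ?sqrtr_ge0
             ?(ltW c0).
have := dotp_ge0 (u - c *: v); rewrite !dotpE (dotpC v u) => sq.
by rewrite -(ler_pM2l c0); nra.
Qed.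

(** * Smooth functions along a line *)

Lemma deriveE_grad (R : realType) (n : nat) (f : 'rV[R]_n -> R)
    (a v : 'rV[R]_n) :
  differentiable f a -> 'D_v f a = dotp (grad f a) v.
Proof.
move=> df; rewrite deriveE // {1}(row_sum_delta v) linear_sum /dotp.
by apply: eq_bigr => i _; rewrite linearZ /= mxE deriveE // mulrC.
Qed.

(** The difference quotients of the one-variable function are literally the
    quotients defining the directional derivative of [f]. *)
Lemma is_derive_line (R : realType) (n : nat) (f : 'rV[R]_n -> R)
    (a v : 'rV[R]_n) (r : R) :
  differentiable f (a + r *: v) ->
  is_derive r 1 (fun r : R => f (a + r *: v)) (dotp (grad f (a + r *: v)) v).
Proof.
move=> df.
have quotE :
    (fun h : R => h^-1 *: (f (a + (h *: 1 + r) *: v) - f (a + r *: v)))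
    = (fun h => h^-1 *: (f (h *: v + (a + r *: v)) - f (a + r *: v))).
  apply/funext => h; congr (_ *: (f _ - _)).
  by rewrite [h *: 1]mulr1 scalerDl addrCA addrA.
split; first by rewrite /derivable quotE; exact: diff_derivable.
by rewrite -deriveE_grad // /derive quotE.
Qed.

(** The mean value theorem applied to [f (a + r v)] minus the claimed quadratic
    upper bound at [r v]: its derivative is nonpositive for [r > 0] because the
    gradient is [L]-Lipschitz. *)
Lemma descent (R : realType) (n : nat) (f : 'rV[R]_n -> R) (L : R)
    (a v : 'rV[R]_n) :
  0 < L -> (forall x, differentiable f x) -> smooth L f ->
  f (a + v) <= f a + dotp (grad f a) v + L / 2 * dotp v v.
Proof.
move=> L0 df fL.
set p := dotp (grad f a) v; set q := dotp v v.
pose g (r : R) := f (a + r *: v) - (p * r + L / 2 * q * r ^+ 2).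
have dg (r : R) :
    is_derive r 1 g (dotp (grad f (a + r *: v)) v - (p + L * q * r)).
  apply: is_deriveB; first exact: is_derive_line.
  by apply: is_derive_eq; rewrite /GRing.scale /=; field.
have [|r] := MVT (f := g) ltr01 (fun r _ => dg r).
  by apply: derivable_within_continuous => r _; case: (dg r).
rewrite in_itv /= => /andP[r0 _].
have := dotp_le_of_enorm L0 (fL (a + r *: v) a).
rewrite addrAC subrr add0r !dotpE -/p -/q => slope.
rewrite /g !scale1r !scale0r addr0 => gE.
have : dotp (grad f (a + r *: v)) v - p <= L * r * q.
  by rewrite -(ler_pM2l r0); lra.
lra.
Qed.

(** * One step of the method *)

(** As [a <= 1], [a >= a^2 = s / A + mu s > mu s]. *)
Lemma mus_lt_ratio (R : realFieldType) (mu s A a : R) :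
  0 < s -> 0 < A -> 0 < a -> A * a ^+ 2 = s * (1 + mu * A) -> a <= 1 ->
  mu * s < a.
Proof.
move=> s0 A0 a0 Aa a1.
have a2_le : 0 <= A * (a * (1 - a)).
  by rewrite !mulr_ge0 ?subr_ge0 ?(ltW A0) ?(ltW a0).
by rewrite -(ltr_pM2l A0); lra.
Qed.

(** The energy estimate for one step, with an arbitrary weight [A] and ratio
    [a] in place of the hyperbolic ones.  The alternative distinguishes the
    initial step, where [b] may be anything, from the later ones. *)
Lemma nag_step (R : realType) (n : nat) (mu s : R) (f : 'rV[R]_n -> R)
    (A a b : R) (xs x z : 'rV[R]_n) :
  let y := x + b *: (z - x) in
  let g := grad f y in
  let z' := z + (s / a) *: (mu *: y - mu *: z - g) in
  0 <= mu -> 0 < s -> strongly_convex mu f ->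
  0 < A -> 0 < a -> A * a ^+ 2 = s * (1 + mu * A) ->
  x = z \/ a <= 1 /\ b * (1 - mu * s) = a - mu * s ->
  f (y - s *: g) <= f y - s / 2 * dotp g g ->
  (1 + mu * A) / 2 * enorm (z' - xs) ^+ 2 + A * (f (y - s *: g) - f xs)
  <= (1 + mu * ((1 - a) * A)) / 2 * enorm (z - xs) ^+ 2
     + (1 - a) * A * (f x - f xs).
Proof.
move=> y g z' mu_ge0 s_gt0 f_sc A0 a0 Aa regime desc.
pose w := z - xs; pose p := y - z; pose q := x - y.
(* The three facts that depend on how [y] lies with respect to [x] and [z]:
   convexity towards [x], cancellation of the gradient terms, and the sign of
   the remaining quadratic form. *)
have [scx orth curv] :
  [/\ (1 - a) * (f y + dotp g q + mu / 2 * dotp q q) <= (1 - a) * f x,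
      (a - mu * s) * dotp g p = (1 - a) * dotp g q
    & 0 <= mu * ((a - mu * s) * dotp p p + (1 - a) * dotp q q)].
  case: regime => [xz|[a1 bE]].
    have yx : y = x by rewrite /y xz subrr scaler0 addr0.
    have -> : p = 0 *: x by rewrite /p yx xz subrr scale0r.
    have -> : q = 0 *: x by rewrite /q yx subrr scale0r.
    by rewrite yx !dotpE; split; lra.
  have pE : p = (b - 1) *: (z - x).
    by rewrite /p /y scalerBl scale1r opprB addrAC addrC.
  have qE : q = (- b) *: (z - x).
    by rewrite /q /y opprD addrA subrr add0r scaleNr.
  have mus_le := ltW (mus_lt_ratio s_gt0 A0 a0 Aa a1).
  have aE : a = b * (1 - mu * s) + mu * s by rewrite bE subrK.
  split.
  - by rewrite ler_wpM2l ?subr_ge0 // -sqr_enorm; exact: f_sc.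
  - by rewrite pE qE !dotpE; ring: aE.
  - by rewrite mulr_ge0 // addr_ge0 // mulr_ge0 ?subr_ge0 ?dotp_ge0.
have scs : f y - dotp g (p + w) + mu / 2 * dotp (p + w) (p + w) <= f xs.
  have := f_sc y xs; rewrite sqr_enorm.
  have -> : xs - y = - (p + w) by rewrite /p /w addrA subrK opprB.
  by rewrite !dotpE; lra.
have zE : z' - xs = w + (s / a) *: (mu *: p - g).
  by rewrite /z' /w -scalerBr -/p addrAC.
have aN0 : a != 0 by rewrite gt_eqF.
(* Writing [1 + mu A] as [A a^2 / s] turns the coefficients of the expanded
   square into multiples of [A]. *)
have distE : (1 + mu * A) / 2 * enorm (z' - xs) ^+ 2 =
  (1 + mu * A) / 2 * dotp w w + a * A * dotp w (mu *: p - g)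
  + s * A / 2 * dotp (mu *: p - g) (mu *: p - g).
  have -> : 1 + mu * A = A * a ^+ 2 / s.
    by rewrite Aa mulrAC divff ?mul1r ?gt_eqF.
  rewrite sqr_enorm zE dotpDl !(dotpDr _ _ (_ *: _)) !dotpZl !dotpZr.
  by rewrite (dotpC _ w); field; rewrite aN0 gt_eqF.
rewrite distE sqr_enorm -/w.
clearbody z' p q w g y.
suff : 0 <= A * ((1 - a) * (f x - f xs) - (f (y - s *: g) - f xs)
  - mu * a / 2 * dotp w w - a * dotp w (mu *: p - g)
  - s / 2 * dotp (mu *: p - g) (mu *: p - g)) by lra.
apply: mulr_ge0; first exact: ltW.
have := ler_wpM2l (ltW a0) scs.
move: scx orth curv desc; rewrite !dotpE.
rewrite (dotpC w p) (dotpC w g) (dotpC p g).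
clear; lra.
Qed.

(** * Hyperbolic coefficients *)

Lemma cosh_gt0 (R : realType) (x : R) : 0 < cosh x.
Proof. by rewrite divr_gt0 ?addr_gt0 ?expR_gt0. Qed.

Lemma sinhc_gt0 (R : realType) (x : R) : 0 <= x -> 0 < sinhc x.
Proof.
rewrite le_eqVlt /sinhc => /orP[/eqP <-|x0]; first by rewrite eqxx.
by rewrite gt_eqF // divr_gt0 // divr_gt0 // subr_gt0 ltr_expR; lra.
Qed.

Lemma sqr_cosh (R : realType) (x : R) :
  cosh x ^+ 2 = 1 + x ^+ 2 * sinhc x ^+ 2.
Proof.
have -> : x ^+ 2 * sinhc x ^+ 2 = sinh x ^+ 2.
  rewrite -exprMn /sinhc; have [->|x0] := eqVneq x 0.
    by rewrite mul0r /sinh oppr0 subrr mul0r.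
  by rewrite mulrCA divff ?mulr1.
by have := expRxMexpNx_1 x; rewrite /cosh /sinh => h; field: h.
Qed.

Definition weight (R : realType) (mu t : R) : R :=
  t ^+ 2 / 4 * sinhc (Num.sqrt mu / 2 * t) ^+ 2.

Definition ratio (R : realType) (mu s t : R) : R :=
  2 * Num.sqrt s / t * cothc (Num.sqrt mu / 2 * t).

Lemma sqr_cosh_weight (R : realType) (mu t : R) : 0 <= mu ->
  cosh (Num.sqrt mu / 2 * t) ^+ 2 = 1 + mu * weight mu t.
Proof.
move=> mu_ge0.
by have := sqr_sqrtr mu_ge0; rewrite sqr_cosh /weight => h; field: h.
Qed.

(** In this form the energy at a given state depends on [t k] through the
    weight only, and is nondecreasing in it. *)
Lemma energyE (R : realType) (n : nat) (mu : R) (f : 'rV[R]_n -> R)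
    (t : nat -> R) (xs : 'rV[R]_n) (x z : nat -> 'rV[R]_n) (k : nat) :
  0 <= mu ->
  energy mu f t xs x z k =
  (1 + mu * weight mu (t k)) / 2 * enorm (z k - xs) ^+ 2
  + weight mu (t k) * (f (x k) - f xs).
Proof.
move=> mu_ge0.
by rewrite /energy sqr_cosh_weight // -/(weight _ _) mul1r [_^-1 * _]mulrC.
Qed.

Lemma sinhc_sqrt_gt0 (R : realType) (mu t : R) : 0 < t ->
  0 < sinhc (Num.sqrt mu / 2 * t).
Proof.
move=> t_gt0.
by rewrite sinhc_gt0 // mulr_ge0 ?divr_ge0 ?sqrtr_ge0 ?(ltW t_gt0).
Qed.

Lemma weight_gt0 (R : realType) (mu t : R) : 0 < t -> 0 < weight mu t.
Proof.
by move=> t_gt0; rewrite mulr_gt0 ?divr_gt0 ?exprn_gt0 ?sinhc_sqrt_gt0.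
Qed.

Lemma ratio_gt0 (R : realType) (mu s t : R) : 0 < s -> 0 < t ->
  0 < ratio mu s t.
Proof.
move=> s_gt0 t_gt0.
have T_gt0 : 0 < tanhc (Num.sqrt mu / 2 * t).
  by apply: divr_gt0; [exact: sinhc_sqrt_gt0 | exact: cosh_gt0].
by apply: mulr_gt0; apply: divr_gt0; rewrite // mulr_gt0 ?sqrtr_gt0.
Qed.

Lemma weight_ratio (R : realType) (mu s t : R) :
  0 <= mu -> 0 < s -> 0 < t ->
  weight mu t * ratio mu s t ^+ 2 = s * (1 + mu * weight mu t).
Proof.
move=> mu_ge0 s_gt0 t_gt0.
have S_gt0 := sinhc_sqrt_gt0 mu t_gt0.
have C_gt0 := cosh_gt0 (Num.sqrt mu / 2 * t).
have := sqr_sqrtr (ltW s_gt0); rewrite -sqr_cosh_weight // => h.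
rewrite /weight /ratio /cothc /tanhc -{2}h.
by field; rewrite !gt_eqF.
Qed.

Lemma mirror_step (R : realType) (mu s t : R) : 0 < s -> 0 < t ->
  Num.sqrt s * t / 2 * tanhc (Num.sqrt mu / 2 * t) = s / ratio mu s t.
Proof.
move=> s_gt0 t_gt0.
have S_gt0 := sinhc_sqrt_gt0 mu t_gt0.
have C_gt0 := cosh_gt0 (Num.sqrt mu / 2 * t).
rewrite -{2}(sqr_sqrtr (ltW s_gt0)) /ratio /cothc /tanhc.
by field; rewrite !gt_eqF ?sqrtr_gt0.
Qed.

(** * Monotonicity of the energy *)

Theorem theorem10 (R : realType) (n : nat) (mu s : R) (f : 'rV[R]_n -> R)
    (xs : 'rV[R]_n) (t : nat -> R) (x y z : nat -> 'rV[R]_n)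
    (mu_ge0 : 0 <= mu) (s_gt0 : 0 < s)
    (f_C1 : continuously_differentiable f)
    (f_sc : strongly_convex mu f)
    (f_smooth : smooth (1 / s) f)
    (xs_min : minimizer f xs)
    (t_ge0 : forall k, 0 <= t k)
    (t_incr : increasing_seq t)
    (t_cond1 : forall k, (2 <= k)%N ->
       2 * Num.sqrt s / t k * cothc (Num.sqrt mu / 2 * t k) <= 1)
    (t_cond2 : forall k,
       (1 - 2 * Num.sqrt s / t k.+1 * cothc (Num.sqrt mu / 2 * t k.+1))
         * (t k.+1 ^+ 2 / 4) * sinhc (Num.sqrt mu / 2 * t k.+1) ^+ 2
       <= t k ^+ 2 / 4 * sinhc (Num.sqrt mu / 2 * t k) ^+ 2)
    (xyz_NAG : unified_NAG mu s f t x y z) :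
  nonincreasing_seq (energy mu f t xs x z).
Proof.
have [f_diff _] := f_C1; have [xz0 NAG] := xyz_NAG.
apply/nonincreasing_seqP => k; rewrite !energyE //.
have t_gt0 : 0 < t k.+1.
  by rewrite (le_lt_trans (t_ge0 k)) // ltNge (t_incr k.+1 k) ltnn.
have A_gt0 := weight_gt0 mu t_gt0.
have a_gt0 := ratio_gt0 mu s_gt0 t_gt0.
have Aa := weight_ratio mu_ge0 s_gt0 t_gt0.
have [-> -> ->] := NAG k; rewrite mirror_step //.
rewrite -/(ratio mu s (t k.+1)).
have step_le u :
    f (u - s *: grad f u) <= f u - s / 2 * dotp (grad f u) (grad f u).
  have := descent u (- (s *: grad f u)) (divr_gt0 ltr01 s_gt0) f_diff f_smooth.
  by rewrite !dotpE; congr (_ <= _); field; rewrite gt_eqF.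
have regime : x k = z k \/ ratio mu s (t k.+1) <= 1 /\
    (ratio mu s (t k.+1) - mu * s) / (1 - mu * s) * (1 - mu * s) =
    ratio mu s (t k.+1) - mu * s.
  case: k {t_gt0} A_gt0 a_gt0 Aa => [|k] A_gt0 a_gt0 Aa; [by left|right].
  have a_le1 : ratio mu s (t k.+2) <= 1 by exact: t_cond1.
  split=> //; rewrite divfK // gt_eqF // subr_gt0.
  exact: lt_le_trans (mus_lt_ratio s_gt0 A_gt0 a_gt0 Aa a_le1) a_le1.
apply: le_trans (nag_step xs mu_ge0 s_gt0 f_sc A_gt0 a_gt0 Aa regime
  (step_le _)) _.
have A_le : (1 - ratio mu s (t k.+1)) * weight mu (t k.+1) <= weight mu (t k).
  by rewrite /weight mulrA; exact: t_cond2.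
apply: lerD; last by rewrite ler_wpM2r // subr_ge0.
by rewrite ler_wpM2r ?sqr_ge0 // ler_wpM2r // lerD2l ler_wpM2l.
Qed.
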